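(* Let $A$ and $B$ be two subspaces of $\mathbb{Z}_{p^s}^n$. Then: (i) the linear subset $A\cap B$ is a subspace (of dimension $\dim(A\cap B)$) if and only if $\rho\begin{pmatrix}A\\ B\end{pmatrix}=\mathrm{rk}\begin{pmatrix}A\\ B\end{pmatrix}$; (ii) $A\vee B$ consists of a single subspace (of dimension $\dim(A\vee B)$) if and only if $\rho\begin{pmatrix}A\\ B\end{pmatrix}=\mathrm{rk}\begin{pmatrix}A\\ B\end{pmatrix}$ or $\dim(A\vee B)=n$.
   Context: $p$ is a prime, $s\ge1$, $R=\mathbb{Z}_{p^s}$; vectors are row vectors. A set $\{\alpha_1,\dots,\alpha_k\}\subseteq R^n$ is unimodular if the matrix with rows $\alpha_i$ has a right inverse. For a submodule $V\subseteq R^n$, $\dim(V)$ is the largest size of a unimodular subset of $V$. A $k$-subspace is a submodule with a unimodular basis of $k$ vectors; a subspace is identified with a matrix whose rows form such a basis, and $\begin{pmatrix}A\\ B\end{pmatrix}$ stacks representations. $A\vee B$ is the set of all subspaces of minimal dimension containing both $A$ and $B$, and $\dim(A\vee B)$ is that minimal dimension. Inner rank: $\rho(M)$ is the least $r$ with $M=CD$, $C$ having $r$ columns ($\rho(0)=0$). McCoy rank: with $I_k(M)$ the ideal generated by $k\times k$ minors ($I_0=R$), $\mathrm{rk}(M)=\max\{k:\mathrm{Ann}_R(I_k(M))=(0)\}$. *)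

(* Defs.v *)
From HB Require Import structures.
From mathcomp Require Import all_boot all_order all_fingroup all_algebra.

Set Implicit Arguments.
Unset Strict Implicit.
Unset Printing Implicit Defensive.

Import GRing.Theory.
Local Open Scope ring_scope.

Section Subspaces.

Variable R : finComNzRingType.

Section FixedDim.

Variable n : nat.
Implicit Types V W A B X : {set 'rV[R]_n}.

Definition unimodular_mx k (M : 'M[R]_(k, n)) : bool :=
  [exists N : 'M[R]_(n, k), M *m N == 1%:M].

Definition mx_of_set X : 'M[R]_(#|X|, n) :=
  \matrix_(i < #|X|) (enum_val i : 'rV[R]_n).

Definition unimodular X : bool := unimodular_mx (mx_of_set X).

Definition sdim V : nat :=
  (\max_(X : {set 'rV[R]_n} | unimodular X && (X \subset V)) #|X|)%N.

Definition row_span k (M : 'M[R]_(k, n)) : {set 'rV[R]_n} :=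
  [set x *m M | x : 'rV[R]_k].

Definition row_indep k (M : 'M[R]_(k, n)) : bool :=
  [forall x : 'rV[R]_k, (x *m M == 0) ==> (x == 0)].

(* The rows of M form a unimodular basis of V. *)
Definition represents k (M : 'M[R]_(k, n)) V : bool :=
  [&& unimodular_mx M, row_indep M & V == row_span M].

Definition k_subspace k V : bool := [exists M : 'M[R]_(k, n), represents M V].

(* A right-invertible k x n matrix over a nonzero commutative ring has k <= n,
   so the bound on k loses nothing. *)
Definition subspace V : bool := [exists k : 'I_n.+1, k_subspace k V].

Definition subspace_above A B W : bool :=
  [&& subspace W, A \subset W & B \subset W].

Definition join A B : {set {set 'rV[R]_n}} :=
  [set W | subspace_above A B W
         & [forall (W' | subspace_above A B W'), (sdim W <= sdim W')%N]].

(* The default setT = R^n is itself a subspace above A and B, so the arg min is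
   a genuine minimizer. *)
Definition dim_join A B : nat :=
  sdim [arg min_(W < [set: 'rV[R]_n] | subspace_above A B W) sdim W]%N.

End FixedDim.

Section Ranks.

Variables m n : nat.
Implicit Type M : 'M[R]_(m, n).

Definition factors_through M (r : nat) : bool :=
  [exists C : 'M[R]_(m, r), [exists D : 'M[R]_(r, n), M == C *m D]].

Lemma factors_through_ex M : exists r, factors_through M r.
Proof.
exists m; apply/existsP; exists 1%:M; apply/existsP; exists M.
by rewrite mul1mx.
Qed.

(* The zero matrix factors through r = 0. *)
Definition inner_rank M : nat := ex_minn (factors_through_ex M).

Definition increasing k l : {set {ffun 'I_k -> 'I_l}} :=
  [set f : {ffun 'I_k -> 'I_l} |
    [forall i : 'I_k, forall j : 'I_k, (i < j)%N ==> (f i < f j)%N]].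

Definition minors k M : {set R} :=
  [set \det (mxsub f g M) | f : {ffun 'I_k -> 'I_m} in increasing k m,
                            g : {ffun 'I_k -> 'I_n} in increasing k n].

Definition ideal_gen (S : {set R}) : {set R} :=
  [set \sum_(a in S) c a * a | c : {ffun R -> R}].

Definition annihilator (I : {set R}) : {set R} :=
  [set x | [forall y in I, x * y == 0]].

(* For k = 0 the only minor is the empty determinant 1, so I_0(M) = R; for
   k > min(m, n) there are no minors and Ann(0) = R is nonzero. *)
Definition mccoy_rank M : nat :=
  (\max_(k < (minn m n).+1
      | annihilator (ideal_gen (minors k M)) == [set 0%R])
     k)%N.

End Ranks.

End Subspaces.

(* Main.v *)
Require Import Defs.
From HB Require Import structures.
From mathcomp Require Import all_boot all_order all_fingroup all_algebra.

Set Implicit Arguments.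
Unset Strict Implicit.
Unset Printing Implicit Defensive.

Import GRing.Theory.
Local Open Scope ring_scope.

(** Write [M] for the stacked matrix and [S] for its row span, the sum of [A]
    and [B].  Over R = Z/p^s an ideal has zero annihilator iff it contains a
    unit, so rk M is the largest order of a unit minor, and a factorization of
    [M] through rk M columns exhibits [S] as a subspace; hence
    rho M = rk M iff [S] is a subspace.

    (i) A submodule V is a subspace iff every element of V killed by p lies in
    p^(s-1) V.  With this criterion, [A :&: B] and [S] are subspaces
    simultaneously by a diagram chase.

    (ii) If [S] is a subspace, it is the only minimal one above [A] and [B].
    Otherwise let W, the row span of [D], be minimal and write M = C D.  Since
    R is self-injective, either [C] has a left inverse, and W = [S], or C x = 0
    for some nonzero column x.  In the latter case, if dim W < n, extend [D] by
    a row v to a larger unimodular family: the row span of D + x v is another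
    minimal subspace. *)

(** * Increasing selections of independent rows over a field *)

Lemma enum_val_increasing m (S : {set 'I_m}) (i j : 'I_#|S|) :
  (i < j)%N -> (enum_val i < enum_val j)%N.
Proof.
move=> lt_ij; set x0 := enum_val i.
rewrite {1}/x0 !(enum_val_nth x0).
have ltT : transitive (fun x y : 'I_m => (x < y)%N).
  by move=> y x z; apply: ltn_trans.
apply: (sorted_ltn_nth ltT) => //; try by rewrite inE -cardE.
rewrite /enum_mem -enumT; apply: sorted_filter => //.
have -> : (fun x y : 'I_m => (x < y)%N) = relpre val ltn by [].
by rewrite -sorted_map val_enum_ord iota_ltn_sorted.
Qed.

Lemma row_free_rowsub (F : fieldType) m n k (h : 'I_k -> 'I_m)
    (M : 'M[F]_(m, n)) :
  injective h -> row_free M -> row_free (rowsub h M).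
Proof.
move=> inj_h /row_freeP[N MN1]; apply/row_freeP; exists (colsub h N).
rewrite -mxsub_mul MN1.
by apply/matrixP => i j; rewrite !mxE (inj_eq inj_h).
Qed.

(** [maxrankfun] supplies independent rows in an uncontrolled order, whereas [minors] ranges over
    increasing selections only. Enumerating the same set of indices in order keeps the row space,
    hence the rank. *)
Lemma row_free_increasing (F : fieldType) m n r (M : 'M[F]_(m, n)) :
  (r <= \rank M)%N ->
  exists2 f, f \in increasing r m & row_free (rowsub f M).
Proof.
move=> le_r; pose g i := maxrankfun M (widen_ord le_r i).
have inj_g : injective g.
  by move=> i j /maxrankfun_inj/(congr1 val)/= /val_inj.
have freeg : row_free (rowsub g M).
  rewrite /g (_ : rowsub _ M = rowsub (widen_ord le_r) (rowsub (maxrankfun M) M)).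
    apply: row_free_rowsub (maxrowsub_free M).
    by move=> i j /(congr1 val)/= /val_inj.
  by apply/matrixP => i j; rewrite !mxE.
pose S := [set g i | i : 'I_r].
have cardS : #|S| = r by rewrite card_imset ?card_ord.
pose f := [ffun i : 'I_r => enum_val (cast_ord (esym cardS) i) : 'I_m].
exists f.
  rewrite inE; apply/forallP => i; apply/forallP => j; apply/implyP => lt_ij.
  by rewrite !ffunE; apply: enum_val_increasing.
rewrite /row_free eqn_leq rank_leq_row /= -[leqLHS](eqP freeg).
apply/mxrankS/row_subP => i.
have gS : g i \in S by apply: imset_f.
pose j := cast_ord cardS (enum_rank_in gS (g i)).
suff -> : row i (rowsub g M) = row j (rowsub f M) by apply: row_sub.
by apply/rowP => l; rewrite !mxE ffunE cast_ordK enum_rankK_in.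
Qed.

Lemma mx_choice (T : Type) m n (P : 'I_m -> 'I_n -> T -> Prop) :
    (forall i j, exists y, P i j y) ->
  exists N : 'M[T]_(m, n), forall i j, P i j (N i j).
Proof.
move=> exP.
have [g gP] := fin_all_exists (fun ij : 'I_m * 'I_n => exP ij.1 ij.2).
by exists (\matrix_(i, j) g (i, j)) => i j; rewrite mxE; apply: (gP (i, j)).
Qed.

(** * Row spans, dimension and joins over a finite commutative ring *)

Section RowSpan.

Variable R : finComUnitRingType.

Lemma unimodularP k n (M : 'M[R]_(k, n)) :
  reflect (exists N, M *m N = 1%:M) (unimodular_mx M).
Proof. by apply: (iffP existsP) => -[N /eqP]; exists N => //; apply/eqP. Qed.

Lemma row_spanP k n (M : 'M[R]_(k, n)) v :
  reflect (exists x, v = x *m M) (v \in row_span M).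
Proof. by apply: (iffP imsetP) => -[x]; exists x. Qed.

Lemma row_indepP k n (M : 'M[R]_(k, n)) :
  reflect (forall x : 'rV_k, x *m M = 0 -> x = 0) (row_indep M).
Proof.
apply: (iffP forallP) => iM x; last by apply/implyP => /eqP/iM ->.
by move=> xM0; move: (iM x); rewrite xM0 eqxx => /eqP.
Qed.

Lemma unimodular_row_indep k n (M : 'M[R]_(k, n)) :
  unimodular_mx M -> row_indep M.
Proof.
case/unimodularP=> N MN1; apply/row_indepP => x xM0.
by rewrite -[x]mulmx1 -MN1 mulmxA xM0 mul0mx.
Qed.

Lemma unimodular_leq k n (M : 'M[R]_(k, n)) : unimodular_mx M -> (k <= n)%N.
Proof. by case/unimodularP => N /mulmx1_min. Qed.

Lemma subspaceP n (V : {set 'rV[R]_n}) :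
  reflect (exists k, exists2 M : 'M_(k, n), unimodular_mx M & V = row_span M)
          (subspace V).
Proof.
apply: (iffP existsP) => [[k /existsP[M /and3P[uM _ /eqP->]]]|[k [M uM ->]]].
  by exists k, M.
have lt_k : (k < n.+1)%N by rewrite ltnS (unimodular_leq uM).
exists (Ordinal lt_k); apply/existsP; exists M.
by apply/and3P; rewrite unimodular_row_indep.
Qed.

Lemma row_span_submod k n (M : 'M[R]_(k, n)) : submod_closed (row_span M).
Proof.
split=> [|a u v /row_spanP[x ->] /row_spanP[y ->]]; apply/row_spanP.
  by exists 0; rewrite mul0mx.
by exists (a *: x + y); rewrite mulmxDl scalemxAl.
Qed.

Lemma row_span_sub k l n (M : 'M[R]_(k, n)) (D : 'M_(l, n)) :
  reflect (exists C, M = C *m D) (row_span M \subset row_span D).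
Proof.
apply: (iffP subsetP) => [sMD | [C ->] _ /row_spanP[x ->]]; last first.
  by apply/row_spanP; exists (x *m C); rewrite mulmxA.
have /fin_all_exists[c cE] : forall i, exists x, row i M = x *m D.
  by move=> i; apply/row_spanP/sMD/row_spanP; exists (delta_mx 0 i); rewrite rowE.
exists (\matrix_i c i); apply/row_matrixP => i.
by rewrite row_mul rowK cE.
Qed.

Lemma row_span_col_mx k l n (M : 'M[R]_(k, n)) (N : 'M_(l, n)) v :
  reflect (exists a b, [/\ a \in row_span M, b \in row_span N & v = a + b])
          (v \in row_span (col_mx M N)).
Proof.
apply: (iffP (row_spanP _ _)) => [[x ->]|[_ [_ [/row_spanP[x ->] /row_spanP[y ->] ->]]]].
  exists (lsubmx x *m M), (rsubmx x *m N).
  split; first by apply/row_spanP; exists (lsubmx x).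
    by apply/row_spanP; exists (rsubmx x).
  by rewrite -[in LHS](hsubmxK x) mul_row_col.
by exists (row_mx x y); rewrite mul_row_col.
Qed.

Lemma row_span_col_mx_sub k l n (M : 'M[R]_(k, n)) (N : 'M_(l, n)) W :
    submod_closed W ->
  (row_span (col_mx M N) \subset W) =
  (row_span M \subset W) && (row_span N \subset W).
Proof.
move=> [W0 WD]; apply/idP/andP => [/subsetP sW|[/subsetP sM /subsetP sN]].
  split; apply/subsetP => v vM; apply/sW/row_span_col_mx.
    exists v, 0; split; rewrite ?addr0 //.
    by case: (row_span_submod N).
  exists 0, v; split; rewrite ?add0r //.
  by case: (row_span_submod M).
apply/subsetP => _ /row_span_col_mx[a [b [/sM aW /sN bW ->]]].
by rewrite -[a]scale1r WD.
Qed.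

Lemma unimodular_rowsub m n k (h : 'I_k -> 'I_m) (M : 'M[R]_(m, n)) :
  injective h -> unimodular_mx M -> unimodular_mx (rowsub h M).
Proof.
move=> inj_h /unimodularP[N MN1]; apply/unimodularP; exists (colsub h N).
rewrite -mxsub_mul MN1.
by apply/matrixP => i j; rewrite !mxE (inj_eq inj_h).
Qed.

Lemma unimodular_row_inj k n (M : 'M[R]_(k, n)) :
  unimodular_mx M -> injective (fun i => row i M).
Proof.
case/unimodularP=> N MN1 i j /= eq_ij; apply/eqP.
have: row i (M *m N) 0 j = row j (M *m N) 0 j by rewrite !row_mul eq_ij.
rewrite MN1 !mxE eqxx; case: (i == j) => // /esym/eqP.
by rewrite oner_eq0.
Qed.

(** A unimodular family inside the span factors as [C *m M], so the identity of its size factors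
    through [k] columns; this bounds the size by [k]. The rows of [M], distinct by unimodularity,
    attain the bound. *)
Lemma sdim_row_span k n (M : 'M[R]_(k, n)) :
  unimodular_mx M -> sdim (row_span M) = k.
Proof.
move=> uM; apply/eqP; rewrite eqn_leq; apply/andP; split.
  apply/bigmax_leqP => X /andP[/unimodularP[N XN1] /subsetP sX].
  have /row_span_sub[C XC] : row_span (mx_of_set X) \subset row_span M.
    have [W0 WD] := row_span_submod M.
    apply/subsetP => _ /row_spanP[x ->]; rewrite mulmx_sum_row.
    elim/big_rec: _ => // i v _ vW; apply: WD => //.
    by rewrite rowK sX ?enum_valP.
  by move: XN1; rewrite XC -mulmxA => /mulmx1_min.
pose X := [set row i M | i : 'I_k].
have cardX : #|X| = k by rewrite card_imset ?card_ord //; apply: unimodular_row_inj.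
apply: (bigmax_sup X); last by rewrite cardX.
apply/andP; split; last first.
  apply/subsetP => _ /imsetP[i _ ->]; apply/row_spanP.
  by exists (delta_mx 0 i); rewrite rowE.
(* The enumeration of [X] may permute the rows of [M]; [h] records how. *)
have /fin_all_exists[h hE] : forall i : 'I_#|X|, exists j, enum_val i = row j M.
  by move=> i; have /imsetP[j _ ->] := enum_valP i; exists j.
rewrite /unimodular (_ : mx_of_set X = rowsub h M).
  apply: unimodular_rowsub uM => i j eq_h.
  by apply: enum_val_inj; rewrite !hE eq_h.
by apply/row_matrixP => i; rewrite rowK hE; apply/rowP => j; rewrite !mxE.
Qed.

Lemma subspace_sdim n (V : {set 'rV[R]_n}) : subspace V ->
  exists2 M : 'M_(sdim V, n), unimodular_mx M & V = row_span M.
Proof.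
case/subspaceP=> k [M uM defV].
have -> : sdim V = k by rewrite defV sdim_row_span.
by exists M.
Qed.

Lemma k_subspace_sdim n (V : {set 'rV[R]_n}) :
  subspace V -> k_subspace (sdim V) V.
Proof.
case/subspace_sdim => M uM defV; apply/existsP; exists M.
by apply/and3P; split; rewrite ?unimodular_row_indep // -defV.
Qed.

Lemma subspace_submod n (V : {set 'rV[R]_n}) : subspace V -> submod_closed V.
Proof. by case/subspaceP=> k [M _ ->]; apply: row_span_submod. Qed.

(** With equal dimensions the transition matrix [C] in [M = C *m D] is square. A right inverse of
    [M] makes it right invertible, hence invertible, so [D] is recovered from [M]. *)
Lemma subspace_eq n (V W : {set 'rV[R]_n}) : subspace V -> subspace W ->
  V \subset W -> sdim V = sdim W -> V = W.
Proof.
case/subspaceP=> k [M uM ->] /subspaceP[l [D uD ->]] sVW.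
rewrite !sdim_row_span // => eq_kl; case: l / eq_kl D uD sVW => D uD sVW.
apply/eqP; rewrite eqEsubset sVW /=; apply/row_span_sub.
have [/row_span_sub[C MC] /unimodularP[N]] := (sVW, uM).
rewrite {1}MC -mulmxA => /mulmx1C CK.
exists (D *m N); rewrite MC.
by rewrite mulmxA CK mul1mx.
Qed.

Lemma sdimS n (V W : {set 'rV[R]_n}) : V \subset W -> (sdim V <= sdim W)%N.
Proof.
move=> sVW; apply/bigmax_leqP => X /andP[uX sXV].
by apply: (bigmax_sup X) => //; rewrite uX (subset_trans sXV).
Qed.

Lemma subspaceT n : subspace [set: 'rV[R]_n].
Proof.
apply/subspaceP; exists n, 1%:M; first by apply/unimodularP; exists 1%:M; rewrite mulmx1.
by apply/esym/setP => v; rewrite inE; apply/row_spanP; exists v; rewrite mulmx1.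
Qed.

Lemma sdimT n : sdim [set: 'rV[R]_n] = n.
Proof.
rewrite -[RHS](@sdim_row_span n n 1%:M).
  congr sdim; apply/setP => v; rewrite inE; apply/esym/row_spanP; exists v.
  by rewrite mulmx1.
by apply/unimodularP; exists 1%:M; rewrite mulmx1.
Qed.

Lemma joinP n (A B W : {set 'rV[R]_n}) :
  reflect (subspace_above A B W /\ sdim W = dim_join A B) (W \in join A B).
Proof.
rewrite inE /dim_join; case: arg_minnP => [|W0 aW0 minW0].
  by rewrite /subspace_above subspaceT !subsetT.
apply: (iffP andP) => [[aW /forall_inP minW]|[aW ->]]; split => //.
  by apply/eqP; rewrite eqn_leq minW ?minW0.
by apply/forall_inP.
Qed.

Lemma join_nonempty n (A B : {set 'rV[R]_n}) : exists W, W \in join A B.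
Proof.
pose W := [arg min_(W < [set: 'rV[R]_n] | subspace_above A B W) sdim W]%N.
exists W; apply/joinP; split=> //; rewrite /W; case: arg_minnP => //.
by rewrite /subspace_above subspaceT !subsetT.
Qed.

End RowSpan.

(* For Z/p^s: F is the residue field, phi the reduction modulo p, pi = p and
   e = s - 1. *)
Record chain_reduction (R : finComUnitRingType) (F : fieldType)
    (phi : {rmorphism R -> F}) (pi : R) (e : nat) : Prop := ChainReduction {
  reduction_surj : forall y, exists x, phi x = y;
  reduction_unit : forall x, phi x != 0 -> x \is a GRing.unit;
  reduction_eq0 : forall x, phi x = 0 -> exists y, x = pi * y;
  uniformizer_ann : forall x, pi * x = 0 -> exists y, x = pi ^+ e * y;
  uniformizer_neq0 : pi ^+ e != 0;
  uniformizer_nilp : pi ^+ e.+1 = 0 }.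

(** * Linear algebra over a finite chain ring, by reduction to the residue field *)

Section ChainRing.

Variables (R : finComUnitRingType) (F : fieldType) (phi : {rmorphism R -> F}).
Variables (pi : R) (e : nat).
Hypothesis cr : chain_reduction phi pi e.

Local Notation "M ^phi" := (map_mx phi M) (at level 2, format "M ^phi").

(** Elements outside the kernel of [phi] are units and cannot kill [pi ^+ e]; those inside are
    multiples of [pi], and [pi ^+ e.+1] vanishes. *)
Lemma socle_eq0 x : (pi ^+ e * x == 0) = (phi x == 0).
Proof.
apply/eqP/eqP => [px0|/(reduction_eq0 cr)[y ->]].
  apply/eqP; apply: contraTT (uniformizer_neq0 cr) => /(reduction_unit cr) ux.
  by rewrite negbK -(mulrK ux (pi ^+ e)) px0 mul0r.
by rewrite mulrA -exprSr (uniformizer_nilp cr) mul0r.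
Qed.

Lemma socle_mx_eq0 m n (M : 'M[R]_(m, n)) : (pi ^+ e *: M == 0) = (M^phi == 0).
Proof.
apply/eqP/eqP => /matrixP M0; apply/matrixP => i j.
  by apply/eqP; move: (M0 i j); rewrite !mxE -socle_eq0 => /eqP.
by apply/eqP; move: (M0 i j); rewrite !mxE socle_eq0 => /eqP.
Qed.

Lemma uniformizer_mx_ann m n (M : 'M[R]_(m, n)) :
  pi *: M = 0 -> exists N, M = pi ^+ e *: N.
Proof.
move=> /matrixP M0.
have /mx_choice[N NP] : forall i j, exists y, M i j = pi ^+ e * y.
  by move=> i j; apply: (uniformizer_ann cr); have:= M0 i j; rewrite !mxE.
by exists N; apply/matrixP => i j; rewrite mxE -NP.
Qed.

Lemma socle_mx_ann m n (M : 'M[R]_(m, n)) :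
  pi ^+ e *: M = 0 -> exists N, M = pi *: N.
Proof.
move=> /matrixP M0.
have /mx_choice[N NP] : forall i j, exists y, M i j = pi * y.
  move=> i j; apply: (reduction_eq0 cr); apply/eqP; rewrite -socle_eq0.
  by have:= M0 i j; rewrite !mxE => ->.
by exists N; apply/matrixP => i j; rewrite mxE -NP.
Qed.

Lemma reduction_mx_surj m n (N : 'M[F]_(m, n)) : exists M : 'M[R]_(m, n), M^phi = N.
Proof.
have [M MN] := mx_choice (fun i j => reduction_surj cr (N i j)).
by exists M; apply/matrixP => i j; rewrite mxE MN.
Qed.

Lemma reduction_unitmx k (M : 'M[R]_k) : M^phi \in unitmx -> M \in unitmx.
Proof.
by rewrite !unitmxE det_map_mx unitfE; apply: (reduction_unit cr).
Qed.

(** Lift a right inverse from the residue field: its product with [M] reduces to the identity, so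
    its determinant is a unit and the lift can be corrected to a true right inverse. *)
Lemma unimodular_reduction k n (M : 'M[R]_(k, n)) :
  unimodular_mx M = row_free M^phi.
Proof.
apply/unimodularP/row_freeP => [[N MN1]|[N' MN1]].
  by exists N^phi; rewrite -map_mxM MN1 map_mx1.
have [N defN] := reduction_mx_surj N'.
have uMN : M *m N \in unitmx.
  by apply: reduction_unitmx; rewrite map_mxM defN MN1 unitmx1.
by exists (N *m invmx (M *m N)); rewrite mulmxA mulmxV.
Qed.

(* Multiplying by the socle generator pi ^+ e turns a relation modulo pi into
   a genuine one; this is the self-injectivity of R. *)
Lemma row_indep_unimodular k n (M : 'M[R]_(k, n)) :
  row_indep M -> unimodular_mx M.
Proof.
move=> /row_indepP iM; rewrite unimodular_reduction -kermx_eq0.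
apply/rowV0P => v /sub_kermxP; have [x <-] := reduction_mx_surj v.
rewrite -map_mxM => /eqP; rewrite -socle_mx_eq0 scalemxAl => /eqP/iM/eqP.
by rewrite socle_mx_eq0 => /eqP.
Qed.

(** Over the residue field some standard basis vector lies outside the row space; any lift of it
    will do. *)
Lemma unimodular_extend k n (M : 'M[R]_(k, n)) : unimodular_mx M -> (k < n)%N ->
  exists v : 'rV_n, unimodular_mx (col_mx M v).
Proof.
rewrite unimodular_reduction => /eqP rM lt_kn.
have /row_subPn[i Ni] : ~~ (1%:M <= M^phi)%MS.
  by rewrite sub1mx /row_full rM neq_ltn lt_kn.
have [v defv] := reduction_mx_surj (row i 1%:M); exists v.
rewrite unimodular_reduction map_col_mx defv /row_free eqn_leq rank_leq_row /=.
suff lt_r : (\rank M^phi < \rank (col_mx M^phi (row i 1%:M)))%N.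
  by apply: leq_trans lt_r; rewrite rM addn1.
rewrite -addsmxE; apply: rank_ltmx; rewrite /ltmx addsmxSl /=.
by apply: contra Ni; apply: submx_trans; apply: addsmxSr.
Qed.

(** * Unit minors, McCoy rank and inner rank *)

Lemma unit_minor r m n (M : 'M[R]_(m, n)) E N : E *m M *m N = 1%:M :> 'M_r ->
  exists2 f, f \in increasing r m & exists2 g, g \in increasing r n &
    mxsub f g M \in unitmx.
Proof.
move=> /(congr1 (map_mx phi)); rewrite !map_mxM map_mx1 => /mulmx1_min_rank.
(* The reduction of [M] has rank at least [r]: select [r] independent rows first, then [r]
   independent columns among these rows. *)
case/row_free_increasing => f f_inc; rewrite /row_free -mxrank_tr => /eqP rf.
have /row_free_increasing[g g_inc free_fg] : (r <= \rank (rowsub f M^phi)^T)%N by rewrite rf.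
exists f => //; exists g => //; apply: reduction_unitmx.
rewrite -unitmx_tr -row_free_unit; move: free_fg.
by congr (row_free _); apply/matrixP => i j; rewrite !mxE.
Qed.

Lemma annihilator_minors k m n (M : 'M[R]_(m, n)) :
  reflect (exists2 f, f \in increasing k m & exists2 g, g \in increasing k n &
             mxsub f g M \in unitmx)
    (annihilator (ideal_gen (minors k M)) == [set 0]).
Proof.
apply: (iffP eqP) => [ann0|[f f_inc [g g_inc u_fg]]]; last first.
  apply/setP => x; rewrite !inE; apply/forall_inP/eqP => [annx|-> y _]; last first.
    by rewrite mul0r.
  pose d := \det (mxsub f g M).
  have d_min : d \in minors k M by apply/imset2P; exists f g.
  have /annx/eqP : d \in ideal_gen (minors k M).
    apply/imsetP; exists [ffun a => (a == d)%:R] => //.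
    rewrite (bigD1 d) //= ffunE eqxx mul1r big1 ?addr0 // => a /andP[_ /negPf ad].
    by rewrite ffunE ad mul0r.
  by move: u_fg; rewrite unitmxE -/d => u_d xd0; rewrite -(mulrK u_d x) xd0 mul0r.
case: (boolP [exists f in increasing k m, exists g in increasing k n,
               mxsub f g M \in unitmx]).
  by case/exists_inP=> f f_inc /exists_inP[g g_inc u_fg]; exists f => //; exists g.
(* If no minor is a unit, the nonzero element [pi ^+ e] kills all of them, hence the ideal they
   generate. *)
move=> no_unit; have /setP/(_ (pi ^+ e)) := ann0; rewrite !inE.
rewrite (negPf (uniformizer_neq0 cr)) => /negP[]; apply/forall_inP.
move=> _ /imsetP[c _ ->]; rewrite mulr_sumr big1 // => _ /imset2P[f g f_inc g_inc ->].
rewrite mulrCA; apply/eqP; suff /eqP-> : pi ^+ e * \det (mxsub f g M) == 0 by rewrite mulr0.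
rewrite socle_eq0; apply: contraNT no_unit => nz_fg.
apply/exists_inP; exists f => //; apply/exists_inP; exists g => //.
by rewrite unitmxE (reduction_unit cr).
Qed.

Lemma mccoy_rank_geq r m n (M : 'M[R]_(m, n)) E N :
  E *m M *m N = 1%:M :> 'M_r -> (r <= mccoy_rank M)%N.
Proof.
move=> EMN1.
have lt_r : (r < (minn m n).+1)%N.
  rewrite ltnS leq_min (mulmx1_min EMN1) andbT.
  by move: EMN1; rewrite -mulmxA => /mulmx1_min.
apply: (bigmax_sup (Ordinal lt_r)) => //.
by apply/annihilator_minors/(unit_minor EMN1).
Qed.

Lemma mccoy_rank_minor m n (M : 'M[R]_(m, n)) :
  exists f g, (mxsub f g M : 'M_(mccoy_rank M)) \in unitmx.
Proof.
have /annihilator_minors[f _ [g _ u_fg]] :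
    annihilator (ideal_gen (minors (mccoy_rank M) M)) == [set 0]; last first.
  by exists f, g.
rewrite /mccoy_rank; elim/big_ind: _ => [|x y annx anny|//]; last first.
  by case: (leqP x y).
(* The default value 0 of the maximum is admissible too: the empty minor is a unit. *)
apply/annihilator_minors/(@unit_minor _ _ _ _ 0 0).
by rewrite [LHS]flatmx0 [RHS]flatmx0.
Qed.

Lemma mccoy_rank_leq_inner m n (M : 'M[R]_(m, n)) :
  (mccoy_rank M <= inner_rank M)%N.
Proof.
have [f [g]] := mccoy_rank_minor M.
rewrite /inner_rank; case: ex_minnP => r /existsP[C /existsP[D /eqP defM]] _.
have -> : mxsub f g M = rowsub f C *m colsub g D by rewrite -mxsub_mul -defM.
by move=> /mulmxV; rewrite -mulmxA => /mulmx1_min.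
Qed.

(** If [M = C *m D] through [mccoy_rank M] columns, a unit minor of that order is a product of
    square blocks of [C] and [D], both invertible; so [D] is unimodular and is a combination of rows
    of [M]. Conversely, for a unimodular basis [D] of the span, [M = C *m D] bounds the inner rank
    above by [k], and [D = E *m M] bounds the McCoy rank below by [k]. *)
Lemma inner_eq_mccoyP m n (M : 'M[R]_(m, n)) :
  inner_rank M = mccoy_rank M <-> subspace (row_span M).
Proof.
split=> [eq_r|/subspaceP[k [D /unimodularP[N DN1] defM]]].
  have [f [g u_fg]] := mccoy_rank_minor M.
  have : factors_through M (mccoy_rank M).
    by rewrite -eq_r /inner_rank; case: ex_minnP.
  case/existsP=> C /existsP[D /eqP defM].
  have Mfg : mxsub f g M = rowsub f C *m colsub g D.
    by rewrite -mxsub_mul -defM.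
  move: u_fg; rewrite Mfg unitmx_mul => /andP[uC uD].
  apply/subspaceP; exists (mccoy_rank M), D.
    apply/unimodularP; exists (colsub g 1%:M *m invmx (colsub g D)).
    by rewrite mulmxA mulmx_colsub mulmx1 mulmxV.
  apply/eqP; rewrite eqEsubset; apply/andP; split; apply/row_span_sub.
    by exists C.
  exists (invmx (rowsub f C) *m rowsub f 1%:M).
  have Mf : rowsub f M = rowsub f C *m D by rewrite mul_rowsub_mx -defM.
  by rewrite -mulmxA mul_rowsub_mx mul1mx Mf mulKmx.
have /eqP := defM; rewrite eqEsubset.
case/andP=> /row_span_sub[C MC] /row_span_sub[E DE].
have le_k : (inner_rank M <= k)%N.
  rewrite /inner_rank; case: ex_minnP => r _; apply.
  by apply/existsP; exists C; apply/existsP; exists D; rewrite -MC.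
apply/eqP; rewrite eqn_leq mccoy_rank_leq_inner andbT (leq_trans le_k) //.
by apply: (@mccoy_rank_geq _ _ _ _ E N); rewrite -DE.
Qed.

(** * The socle criterion for a submodule to be a subspace *)

Lemma row_span_socle k n (M : 'M[R]_(k, n)) v : row_indep M ->
  v \in row_span M -> pi *: v = 0 ->
  exists2 w, w \in row_span M & v = pi ^+ e *: w.
Proof.
move=> /row_indepP iM /row_spanP[x ->]; rewrite scalemxAl => /iM.
case/uniformizer_mx_ann=> y ->; exists (y *m M); last by rewrite scalemxAl.
by apply/row_spanP; exists y.
Qed.

(** The counterpart of [row_span_socle] with [pi] and [pi ^+ e] exchanged; both are read off on
    coordinates. The diagram chase for [A :&: B] and the sum uses the two together. *)
Lemma row_span_radical k n (M : 'M[R]_(k, n)) v : row_indep M ->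
  v \in row_span M -> pi ^+ e *: v = 0 ->
  exists2 w, w \in row_span M & v = pi *: w.
Proof.
move=> /row_indepP iM /row_spanP[x ->]; rewrite scalemxAl => /iM.
case/socle_mx_ann=> y ->; exists (y *m M); last by rewrite scalemxAl.
by apply/row_spanP; exists y.
Qed.

(* Split off a maximal unimodular family of V with right inverse N; if it does
   not span V, some nonzero socle element w = pi ^+ e *: u of V lies in the
   complement {w | w *m N = 0}, and u, projected to this complement, extends
   the family. *)
Lemma subspace_socle n (V : {set 'rV[R]_n}) : submod_closed V ->
    (forall v, v \in V -> pi *: v = 0 ->
       exists2 w, w \in V & v = pi ^+ e *: w) ->
  subspace V.
Proof.
move=> [V0 VD] Vsoc.
have Vadd u v : u \in V -> v \in V -> u + v \in V.
  by move=> uV vV; rewrite -[u]scale1r VD.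
have Vscale a u : u \in V -> a *: u \in V.
  by move=> uV; rewrite -[_ *: _]addr0 VD.
have Vsub u v : u \in V -> v \in V -> u - v \in V.
  by move=> uV vV; rewrite -scaleN1r addrC VD.
pose P k := [exists M : 'M[R]_(k, n), unimodular_mx M && (row_span M \subset V)].
have exP : exists k, P k.
  exists 0; apply/existsP; exists 0; apply/andP; split.
    by apply/unimodularP; exists 0; rewrite [LHS]flatmx0 [RHS]flatmx0.
  by apply/subsetP => _ /row_spanP[x ->]; rewrite mulmx0.
have leP k : P k -> (k <= n)%N.
  by case/existsP=> M /andP[/unimodular_leq].
case: (ex_maxnP exP leP) => k /existsP[M /andP[uM sMV]] maxk.
apply/subspaceP; exists k, M => //; apply/eqP; rewrite eqEsubset sMV andbT.
apply/negPn/negP => /subsetPn[v vV vM].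
have [N MN1] := unimodularP _ uM.
pose pr (u : 'rV[R]_n) := u - u *m N *m M.
have prN u : pr u *m N = 0.
  by rewrite mulmxBl -[_ *m M *m N]mulmxA MN1 mulmx1 subrr.
have prV u : u \in V -> pr u \in V.
  by move=> uV; apply: Vsub => //; apply: (subsetP sMV); apply/row_spanP; exists (u *m N).
have prZ a u : pr (a *: u) = a *: pr u by rewrite /pr -!scalemxAl scalerBr.
have nzv : pr v != 0.
  by apply: contra vM; rewrite subr_eq0 => /eqP->; apply/row_spanP; exists (v *m N).
(* The last nonzero multiple of [pr v] by a power of [pi] is an element of [V] killed by [pi]. *)
have exj : exists j, pi ^+ j *: pr v == 0.
  by exists e.+1; rewrite (uniformizer_nilp cr) scale0r.
case: (ex_minnP exj) => -[|j]; first by rewrite expr0 scale1r (negPf nzv).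
rewrite exprS -scalerA => /eqP pj0 /(_ j) minj.
have [||u uV defu] := Vsoc (pi ^+ j *: pr v) => //; first exact/Vscale/prV.
(* As [pr] is linear and idempotent, this vector is [pi ^+ j *: pr v], nonzero by minimality. *)
have nz_pu : pi ^+ e *: pr u != 0.
  rewrite -prZ -defu prZ {1}/pr prN mul0mx subr0.
  by apply/negP => /minj; rewrite ltnn.
suff /maxk : P (k + 1)%N by rewrite addn1 ltnn.
apply/existsP; exists (col_mx M (pr u)); apply/andP; split; last first.
  apply/subsetP => _ /row_span_col_mx[a [b [/(subsetP sMV) aV /row_spanP[x ->] ->]]].
  by apply: Vadd => //; rewrite [x]mx11_scalar mul_scalar_mx; apply/Vscale/prV.
apply/row_indep_unimodular/row_indepP => x.
rewrite -[x]hsubmxK mul_row_col => x0.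
(* Multiplication by [N] kills [pr u] and isolates the coefficients on [M]. *)
have xl0 : lsubmx x = 0.
  have := congr1 (mulmx^~ N) x0.
  by rewrite /= mulmxDl -!mulmxA MN1 prN mulmx1 mulmx0 addr0 mul0mx.
move: x0; rewrite xl0 mul0mx add0r [rsubmx x]mx11_scalar mul_scalar_mx.
move: (rsubmx x 0 0) => y /rowP yu0.
(* A unit coordinate of [pr u] then forces the remaining coefficient [y] to vanish. *)
have [i nz_i] : exists i, phi (pr u 0 i) != 0.
  apply/existsP; apply: contraNT nz_pu; rewrite negb_exists => /forallP u0.
  rewrite socle_mx_eq0; apply/eqP/rowP => i; rewrite !mxE.
  by have := u0 i; rewrite negbK !mxE => /eqP.
have := yu0 i; rewrite mxE [RHS]mxE => yui.
rewrite -(mulrK (reduction_unit cr nz_i) y) yui mul0r.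
by rewrite raddf0 row_mx0.
Qed.

(** * Intersection, sum and join of two subspaces *)

Section TwoSubspaces.

Variables (n k l : nat) (A B : {set 'rV[R]_n}).
Variables (MA : 'M[R]_(k, n)) (MB : 'M[R]_(l, n)).
Hypotheses (repA : represents MA A) (repB : represents MB B).

Local Notation S := (row_span (col_mx MA MB)).

Lemma subspace_cap_sum : subspace (A :&: B) <-> subspace S.
Proof.
case/and3P: repA => _ iA /eqP defA; case/and3P: repB => _ iB /eqP defB.
have [A0 AD] : submod_closed A by rewrite defA; apply: row_span_submod.
have [B0 BD] : submod_closed B by rewrite defB; apply: row_span_submod.
split=> /subspaceP[r [D /unimodular_row_indep iD defD]]; apply: subspace_socle.
- exact: row_span_submod.
- move=> v /row_span_col_mx[a [b [aA bB ->]]]; rewrite -defA -defB in aA bB.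
  rewrite scalerDr => /eqP; rewrite addr_eq0 => /eqP pab.
  (* Since [pi *: a = - (pi *: b)] lies in [A :&: B] and is killed by [pi ^+ e], it equals [pi *: c]
     with [c] in [A :&: B]. Then [a - c] and [b + c] are killed by [pi], and they still add up to
     [v]. *)
  have paI : pi *: a \in row_span D.
    rewrite -defD inE; apply/andP; split; first by rewrite -[_ *: _]addr0 AD.
    by rewrite pab -scalerN -[_ *: _]addr0 BD // -scaleN1r -[_ *: _]addr0 BD.
  have [|c cD /eqP pac] := row_span_radical iD paI.
    by rewrite scalerA -exprSr (uniformizer_nilp cr) scale0r.
  move: cD; rewrite -defD inE => /andP[cA cB].
  have [||a' a'A defa] := @row_span_socle _ _ MA (a - c) iA.
  + by rewrite -defA addrC -scaleN1r AD.
  + by apply/eqP; rewrite scalerBr subr_eq0.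
  have [||b' b'B defb] := @row_span_socle _ _ MB (b + c) iB.
  + by rewrite -defB -[b]scale1r BD.
  + by rewrite scalerDr -(eqP pac) pab addrC addNr.
  exists (a' + b'); first by apply/row_span_col_mx; exists a', b'.
  by rewrite scalerDr -defa -defb addrACA addNr addr0.
- split=> [|a u v]; first by rewrite inE A0.
  by rewrite !inE => /andP[uA uB] /andP[vA vB]; rewrite AD ?BD.
move=> v /setIP[vA vB] pv0; rewrite defA in vA; rewrite defB in vB.
have [a aA defa] := row_span_socle iA vA pv0.
have [b bB defb] := row_span_socle iB vB pv0.
(* Here [v = pi ^+ e *: a = pi ^+ e *: b], so [a - b] is killed by [pi ^+ e] and equals
   [pi *: (a' + b')]. Hence [a - pi *: a' = b + pi *: b'] lies in both subspaces, and [pi ^+ e]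
   sends it to [v]. *)
have abS : a - b \in row_span D.
  rewrite -defD; apply/row_span_col_mx; exists a, (- b); split=> //.
  by rewrite -defB -scaleN1r -[_ *: _]addr0 BD ?defB // -defB.
have [|c] := row_span_radical iD abS; first by rewrite scalerBr -defa -defb subrr.
rewrite -defD => /row_span_col_mx[a' [b' [a'A b'B ->]]] /eqP.
rewrite scalerDr subr_eq -addrA addrC -subr_eq => /eqP defab.
rewrite -defA in aA a'A; rewrite -defB in bB b'B.
exists (a - pi *: a'); last first.
  by rewrite scalerBr scalerA -exprSr (uniformizer_nilp cr) scale0r subr0.
rewrite inE {2}defab BD // andbT.
by rewrite addrC -scaleNr AD.
Qed.

Lemma above_sum W : subspace_above A B W = subspace W && (S \subset W).
Proof.
case/and3P: repA => _ _ /eqP ->; case/and3P: repB => _ _ /eqP ->.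
rewrite /subspace_above; case: (boolP (subspace W)) => //= sW.
by rewrite row_span_col_mx_sub //; apply: subspace_submod.
Qed.

Lemma join_unique_sum W : join A B = [set W] -> dim_join A B != n -> W = S.
Proof.
move=> defJ dimJ; have /joinP[] : W \in join A B by rewrite defJ set11.
rewrite above_sum => /andP[/subspaceP[t [D uD defW]] sSW].
rewrite {1}defW sdim_row_span // => dimW.
have lt_tn : (t < n)%N by rewrite ltn_neqAle dimW dimJ -dimW (unimodular_leq uD).
have [C defC] : exists C, col_mx MA MB = C *m D.
  by apply/row_span_sub; rewrite -defW.
(* Transposed, the dichotomy of [row_indep_unimodular] reads: [C] has a left inverse, or it kills a
   nonzero column. *)
case: (boolP (unimodular_mx C^T)) => [/unimodularP[E CE]|].
  apply/eqP; rewrite eqEsubset sSW andbT defW; apply/row_span_sub; exists E^T.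
  by rewrite defC mulmxA -[C]trmxK -trmx_mul CE trmx1 mul1mx.
move/(contra (@row_indep_unimodular _ _ _)); rewrite negb_forall.
case/existsP=> y; rewrite negb_imply => /andP[/eqP yC nz_y].
have [v /unimodularP[N]] := unimodular_extend uD lt_tn.
(* The left block of [N] inverts [D] and kills [v], so it also inverts [D']; the right block kills
   [D] and sends [v] to 1. *)
rewrite -[N]hsubmxK mul_col_row scalar_mx_block => /eq_block_mx[DN1 DN2 vN1 vN2].
(* [C *m y^T = 0], so [C *m D' = C *m D] and [S] also lies below [D']. *)
pose D' := D + y^T *m v.
have uD' : unimodular_mx D'.
  by apply/unimodularP; exists (lsubmx N); rewrite mulmxDl DN1 -mulmxA vN1 mulmx0 addr0.
have D'J : row_span D' \in join A B.
  apply/joinP; split; last by rewrite sdim_row_span.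
  rewrite above_sum; apply/andP; split; first by apply/subspaceP; exists t, D'.
  apply/row_span_sub; exists C; rewrite mulmxDr defC mulmxA.
  by rewrite -[C *m y^T]trmxK trmx_mul trmxK yC trmx0 mul0mx addr0.
move: D'J; rewrite defJ inE defW => /eqP defD'.
(* Applied to [D + y^T *m v = Q *m D], the right block of [N] leaves [y^T = 0], a contradiction. *)
have /row_span_sub[Q /(congr1 (mulmx^~ (rsubmx N)))] : row_span D' \subset row_span D.
  by rewrite defD'.
rewrite /= mulmxDl -!mulmxA DN2 vN2 mulmx0 mulmx1 add0r => /(congr1 trmx).
by rewrite trmxK trmx0 => y0; rewrite y0 eqxx in nz_y.
Qed.

Lemma join_single : (exists W, join A B = [set W]) <->
  subspace S \/ dim_join A B = n.
Proof.
split=> [[W defJ]|].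
  case: (eqVneq (dim_join A B) n) => [|dimJ]; [by right | left].
  rewrite -(join_unique_sum defJ dimJ).
  by have /joinP[/and3P[]] : W \in join A B by rewrite defJ set11.
have [W WJ] := join_nonempty A B => dimS; exists W; apply/setP => W'; rewrite inE.
apply/idP/eqP => [W'J|-> //].
have [[aW dimW] [aW' dimW']] := (joinP _ _ _ WJ, joinP _ _ _ W'J).
move: aW aW'; rewrite !above_sum => /andP[sW SW] /andP[sW' SW'].
case: dimS => [sS|dimn]; last first.
  have eqT W0 : subspace W0 -> sdim W0 = n -> W0 = [set: 'rV[R]_n].
    move=> sW0 dimW0; apply: (subspace_eq sW0 (@subspaceT R n)); first exact: subsetT.
    by rewrite sdimT.
  by rewrite (eqT W) ?dimW // (eqT W') ?dimW'.
(* A sum that is a subspace lies below every competitor, so it is minimal, and equal dimensions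
   force [W] and [W'] to coincide with it. *)
have SJ : S \in join A B.
  have : [forall (W0 | subspace_above A B W0), (sdim S <= sdim W0)%N].
    apply/forall_inP => W0; rewrite above_sum => /andP[sW0 SW0].
    exact: sdimS.
  by rewrite [S \in _]inE above_sum sS subxx.
have dimS : sdim S = dim_join A B by case/joinP: SJ.
by rewrite -(subspace_eq sS sW' SW') ?dimW' // -(subspace_eq sS sW SW) ?dimW.
Qed.

Theorem chain_ring_cap_join :
  ((subspace (A :&: B) <->
      inner_rank (col_mx MA MB) = mccoy_rank (col_mx MA MB))
   /\ (subspace (A :&: B) -> k_subspace (sdim (A :&: B)) (A :&: B)))
  /\
  (((exists W, join A B = [set W]) <->
      inner_rank (col_mx MA MB) = mccoy_rank (col_mx MA MB)
      \/ dim_join A B = n)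
   /\ (forall W, join A B = [set W] -> k_subspace (dim_join A B) W)).
Proof.
have [rkS Srk] := inner_eq_mccoyP (col_mx MA MB).
have [capS Scap] := subspace_cap_sum; have [joinS Sjoin] := join_single.
split; split.
- by split=> [/capS/Srk | /rkS/Scap].
- exact: k_subspace_sdim.
- split=> [/joinS[/Srk|]|[/rkS|] ?]; [by left | by right | |].
    by apply: Sjoin; left.
  by apply: Sjoin; right.
move=> W defJ; have /joinP[/and3P[sW _ _] <-] : W \in join A B.
  by rewrite defJ set11.
exact: k_subspace_sdim.
Qed.

End TwoSubspaces.

End ChainRing.

(** * The integers modulo a prime power as a chain ring *)

Lemma Zp_natr_eq0 q m : (1 < q)%N -> (m%:R == 0 :> 'Z_q) = (q %| m)%N.
Proof. by move=> q_gt1; rewrite -val_eqE /= val_Zp_nat. Qed.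

Lemma Fp_natr_eq0 p m : prime p -> (m%:R == 0 :> 'F_p) = (p %| m)%N.
Proof. by move=> p_pr; rewrite (dvdn_pcharf (pchar_Fp p_pr)). Qed.

Lemma Fp_natr_mod p q m : prime p -> (p %| q)%N -> (m %% q)%:R = m%:R :> 'F_p.
Proof.
move=> p_pr; rewrite -Fp_natr_eq0 // => /eqP q0.
by rewrite [in RHS](divn_eq m q) natrD natrM q0 mulr0 add0r.
Qed.

Lemma Zpn_chain_reduction p e : prime p ->
  exists phi : {rmorphism 'Z_(p ^ e.+1) -> 'F_p}, chain_reduction phi p%:R e.
Proof.
move=> p_pr; set q := (p ^ e.+1)%N.
have p_gt1 := prime_gt1 p_pr; have p_gt0 := prime_gt0 p_pr.
(* The type ['Z_q] has modulus [q] only for [q] above 1. *)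
have q_gt1 : (1 < q)%N by rewrite -(exp1n e.+1) ltn_exp2r.
have p_dvd_q : (p %| q)%N by rewrite /q expnS dvdn_mulr.
(* Reduction of the canonical representative; it respects the operations because [p] divides [q]. *)
pose f (x : 'Z_q) : 'F_p := (x : nat)%:R.
have f_nat m : f m%:R = m%:R by rewrite /f val_Zp_nat // Fp_natr_mod.
have fD : {morph f : x y / x + y}.
  by move=> x y; rewrite -[x in LHS]natr_Zp -[y in LHS]natr_Zp -natrD f_nat natrD.
have fB : zmod_morphism f.
  by move=> x y; apply: (addIr (f y)); rewrite -fD !subrK.
have fM : monoid_morphism f.
  split=> [|x y]; first by rewrite -[1]/(1%:R) f_nat.
  by rewrite -[x in LHS]natr_Zp -[y in LHS]natr_Zp -natrM f_nat natrM.
pose fA := GRing.isZmodMorphism.Build _ _ f fB.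
pose fR := GRing.isMonoidMorphism.Build _ _ f fM.
pose phi : {rmorphism 'Z_q -> 'F_p} := HB.pack f fA fR.
exists phi; split=> [y|x|x|x||].
- by exists (y : nat)%:R; rewrite [LHS]f_nat natr_Zp.
- rewrite /= /f Fp_natr_eq0 // => p_x; rewrite -[x]natr_Zp unitZpE //.
  by rewrite coprime_pexpl // prime_coprime.
- move=> /eqP; rewrite /= /f Fp_natr_eq0 // => p_x.
  by exists (x %/ p)%:R; rewrite -natrM mulnC divnK // natr_Zp.
- rewrite -{1}[x]natr_Zp -natrM => /eqP; rewrite Zp_natr_eq0 // => q_px.
  have p_x : (p ^ e %| x)%N by rewrite -(dvdn_pmul2l p_gt0) -expnS.
  exists (x %/ p ^ e)%:R.
  by rewrite -natrX -natrM mulnC divnK // natr_Zp.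
- by rewrite -natrX Zp_natr_eq0 // dvdn_Pexp2l // ltnn.
by apply/eqP; rewrite -natrX Zp_natr_eq0.
Qed.

Theorem theorem3p5 (p s n : nat) (p_prime : prime p) (s_gt0 : (0 < s)%N)
    (A B : {set 'rV['Z_(p ^ s)]_n}) (k l : nat)
    (MA : 'M['Z_(p ^ s)]_(k, n)) (MB : 'M['Z_(p ^ s)]_(l, n))
    (repA : represents MA A) (repB : represents MB B) :
  ((subspace (A :&: B) <->
      inner_rank (col_mx MA MB) = mccoy_rank (col_mx MA MB))
   /\ (subspace (A :&: B) -> k_subspace (sdim (A :&: B)) (A :&: B)))
  /\
  (((exists W : {set 'rV['Z_(p ^ s)]_n}, join A B = [set W]) <->
      inner_rank (col_mx MA MB) = mccoy_rank (col_mx MA MB)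
      \/ dim_join A B = n)
   /\ (forall W : {set 'rV['Z_(p ^ s)]_n},
         join A B = [set W] -> k_subspace (dim_join A B) W)).
Proof.
(* Writing [s] as [e.+1] makes [p ^ e] the socle generator. *)
case: s s_gt0 A B MA MB repA repB => // e _ A B MA MB repA repB.
have [phi cr] := Zpn_chain_reduction e p_prime.
exact: (chain_ring_cap_join cr repA repB).
Qed.
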